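(* Let $D$ be a Go-diagram inside a partition $\lambda\in\Lambda_{k,n}$, and let $\{\beta_b\}_{b\in\lambda}$ be jump parameters with $\beta_b\in\mathbb F$ at cells with $\bullet$, $\beta_b\in\mathbb F^*$ at cells with $+$ and $\beta_b=0$ at cells with $\circ$. Then $$\tilde R_D=\prod_{b\in\lambda}X_{\sigma_D(b)}(\beta_b),$$ where the ordering of the factors is decided by a (any) reading order on $\lambda$: cells with a higher index in the reading order appear to the left of the ones with a lower index.
   Context: **Partitions and pipe dreams.** Let $k\le n$ be natural numbers, $\mathbb F=\mathbb R$ or $\mathbb C$, $\mathbb F^*=\mathbb F\setminus\{0\}$. $\Lambda_{k,n}$ is the set of partitions $\lambda=(\lambda_1\ge\dots\ge\lambda_k\ge 0)$ with $\lambda_1\le n-k$; $\lambda$ is identified with its Young diagram (English notation) in the top-left corner of a rectangle with $k$ rows and $n-k$ columns. The south-east border of $\lambda$ is the lattice path from the north-east corner to the south-west corner of the rectangle bounding $\lambda$; its $n$ unit edges are labelled $1,\dots,n$ starting from the north-east end. The north-west border consists of the top and left sides of the rectangle. A pipe dream on $\lambda$ is a filling of every cell by a crossing tile or an elbow tile. Pipe $j$ starts at the south-east border edge labelled $j$ and travels to the north-west border: it enters each cell through its east or south edge; in a crossing tile east continues to west and south continues to north; in an elbow tile east turns to north and south turns to west. Each edge of the north-west border is labelled by the index of the pipe exiting there. Given a pipe dream, write $+$ in each elbow cell; in a crossing cell write $\circ$ (white stone) if the pipe entering from the east has the smaller index of the two pipes, and $\bullet$ (black stone) if the pipe entering from the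 east has the larger index. A pipe dream is a Go-diagram if in no elbow cell the pipe entering from the east has larger index than the pipe entering from the south. **Restricted paths.** The edges of the north-west border are sources, those of the south-east border are sinks. A restricted path goes from a source to a sink along the pipes of $D$ (traversed from the north-west border towards the south-east border), following the pipe it is on, except that upon entering a cell with $+$ or $\bullet$ it may alternatively jump to the other pipe of that cell provided that pipe has the lower index. A cell where it changes pipes is a jump site. The weight of a restricted path is the product of the jump parameters $\beta_b$ at its jump sites. $\tilde R_D$ is the $n\times n$ matrix whose $(s,t)$ entry is the sum of the weights of all restricted paths from the source labelled $s$ to the sink labelled $t$. **Other notation.** $\sigma_D(b)=(i,j)$, the jump coordinate of $b$, where $i$ is the index of the pipe exiting $b$ through its left edge and $j$ is the index of the other pipe through $b$. $X_{(i,j)}(\beta)$ is the $n\times n$ matrix with $1$'s on the diagonal and whose only other possibly nonzero entry is $\beta$, in row $i$ and column $j$. A reading order on $\lambda$ is a bijective filling of the cells with $1,\dots,|\lambda|$ whose entries decrease from left to right in rows and from top to bottom in columns. *)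

(* Defs.v *)
From mathcomp Require Import all_boot all_order all_algebra.
From mathcomp Require Import reals complex.

Set Implicit Arguments.
Unset Strict Implicit.
Unset Printing Implicit Defensive.

Import GRing.Theory.

Local Open Scope ring_scope.

Variant scalars := RealScalars | ComplexScalars.

Definition scalar_field (R : realType) (s : scalars) : fieldType :=
  match s with RealScalars => R | ComplexScalars => R[i] end.

(* The set Lambda_{k,n}. *)
Record box_partition (k n : nat) := BoxPartition {
  parts :> k.-tuple nat;
  parts_sorted : sorted geq parts;
  parts_le : (nth 0 parts 0 <= n - k)%N
}.

Section Diagrams.
Variables (k n : nat) (lam : box_partition k n).

(* Rows and columns are numbered from 0, from the top and from the left. *)
Definition cell : finType :=
  {b : 'I_k * 'I_(n - k) | (b.2 < tnth lam b.1)%N}.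

Definition cell_row (b : cell) : 'I_k := (val b).1.
Definition cell_col (b : cell) : 'I_(n - k) := (val b).2.

(* Unit segments of the k x (n - k) grid: [inl (r, x)] is the vertical segment
   of row r at distance x from the left side of the rectangle, [inr (y, c)] is
   the horizontal segment of column c at distance y from its top side. *)
Definition edge : finType :=
  ('I_k * 'I_(n - k).+1 + 'I_k.+1 * 'I_(n - k))%type.

Definition west (b : cell) : edge := inl (cell_row b, inord (cell_col b)).
Definition east (b : cell) : edge := inl (cell_row b, inord (cell_col b).+1).
Definition north (b : cell) : edge := inr (inord (cell_row b), cell_col b).
Definition south (b : cell) : edge := inr (inord (cell_row b).+1, cell_col b).

Definition nw_edges (b : cell) : seq edge := [:: west b; north b].
Definition se_edges (b : cell) : seq edge := [:: east b; south b].

(* The segments of an empty row or column on the left or top side of the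
   rectangle lie on both borders. *)
Definition nw_border (e : edge) : bool :=
  match e with
  | inl (_, x) => x == 0%N :> nat
  | inr (y, _) => y == 0%N :> nat
  end.

Definition se_border (e : edge) : bool :=
  match e with
  | inl (r, x) => x == tnth lam r :> nat
  | inr (y, c) => y == count (fun p => c < p)%N lam :> nat
  end.

(* The label of an edge of the south-east border, shifted from 1..n to
   0..n-1 so as to index matrices.  It counts the preceding edges of the border,
   i.e. the south and west unit steps from the north-east corner of the
   rectangle to the first endpoint of the edge. *)
Definition se_label (e : edge) : nat :=
  match e with
  | inl (r, x) => (r + (n - k - x))%N
  | inr (y, c) => (y + (n - k - c.+1))%N
  end.

Variant tile := Cross | Elbow.

Definition pipe_dream := cell -> tile.

Variable D : pipe_dream.

(* The east or south edge of [b] through which the pipe leaving [b] by its west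
   or north edge [e] has entered. *)
Definition pipe_entry (b : cell) (e : edge) : edge :=
  match D b with
  | Cross => if e == west b then east b else south b
  | Elbow => if e == west b then south b else east b
  end.

Definition pipe_back (e : edge) : edge :=
  if [pick b | e \in nw_edges b] is Some b then pipe_entry b e else e.

(* The index of the pipe running along [e], read off at its starting edge.  Going
   backwards every step moves east or south and the south-east border is fixed,
   so n iterations reach the start of the pipe. *)
Definition pipe_index (e : edge) : nat := se_label (iter n pipe_back e).

Variant mark := Plus | WhiteStone | BlackStone.

(* The two pipes through a cell are always distinct. *)
Definition cell_mark (b : cell) : mark :=
  match D b with
  | Elbow => Plus
  | Cross => if (pipe_index (east b) < pipe_index (south b))%N
             then WhiteStone else BlackStone
  end.

Definition go_diagram : Prop :=
  forall b, D b = Elbow -> ~ (pipe_index (east b) > pipe_index (south b))%N.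

Definition jump_coordinate (b : cell) : nat * nat :=
  (pipe_index (west b), pipe_index (north b)).

(* A path is recorded by the successive edges it crosses, from the north-west to
   the south-east border.  Having entered [b] through [e], it leaves through
   [e'], either along its pipe or along the other pipe of [b]. *)
Definition follows (b : cell) (e e' : edge) : bool :=
  (e \in nw_edges b) && (e' == pipe_entry b e).

Definition jumps (b : cell) (e e' : edge) : bool :=
  [&& e \in nw_edges b, e' \in se_edges b, e' != pipe_entry b e,
      (if cell_mark b is WhiteStone then false else true)
    & (pipe_index e' < pipe_index e)%N].

Definition restricted_step (e e' : edge) : bool :=
  [exists b, follows b e e' || jumps b e e'].

Definition restricted_path (e : edge) (p : seq edge) : bool :=
  [&& nw_border e, path restricted_step e p & se_border (last e p)].

Definition jump_site (e : edge) (p : seq edge) (b : cell) : bool :=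
  has (fun ee' => jumps b ee'.1 ee'.2) (zip (e :: p) p).

Section Weights.
Variables (F : fieldType) (beta : cell -> F).

Definition jump_parameters : Prop :=
  forall b, match cell_mark b return Prop with
            | BlackStone => True
            | Plus => beta b != 0
            | WhiteStone => beta b = 0
            end.

Definition path_weight (e : edge) (p : seq edge) : F :=
  \prod_(b | jump_site e p b) beta b.

(* Every step of a path moves east or south, so a path has fewer than n steps
   and the bound in [{bseq n of edge}] excludes none. *)
Definition Rtilde : 'M[F]_n :=
  \matrix_(s < n, t < n)
    \sum_(e : edge | pipe_index e == s)
      \sum_(p : {bseq n of edge} |
            restricted_path e p && (se_label (last e p) == t))
        path_weight e p.

End Weights.

Definition reading_order (rd : cell -> nat) : Prop :=
  [/\ perm_eq [seq rd b | b <- enum cell] (iota 1 #|cell|),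
      forall b b', cell_row b = cell_row b' ->
        (cell_col b < cell_col b')%N -> (rd b' < rd b)%N
    & forall b b', cell_col b = cell_col b' ->
        (cell_row b < cell_row b')%N -> (rd b' < rd b)%N].

End Diagrams.

Definition X_mx (F : fieldType) (n : nat) (ij : nat * nat) (a : F) : 'M[F]_n :=
  \matrix_(s < n, t < n)
    if s == t then 1
    else if (s == ij.1 :> nat) && (t == ij.2 :> nat) then a else 0.

(* Main.v *)
Require Import Defs.
From mathcomp Require Import all_boot all_order all_algebra.
From mathcomp Require Import reals complex.
From mathcomp Require Import zify ring.

Set Implicit Arguments.
Unset Strict Implicit.
Unset Printing Implicit Defensive.

Import GRing.Theory.

Local Open Scope ring_scope.

(** Cut the diagram along a lattice path, keeping the cells that come last in
    the product (those of small reading number); they form a set [Q] closed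
    under moving south or east.  The north-west boundary of [Q] together with
    the part of the south-east border that [Q] does not touch is the frontier of
    [Q]: a path of n edges crossed once by each of the n pipes.  The claim proved
    by induction on [Q] ([frontier_invariant]) is that the pipe indices on the
    frontier are 0, ..., n-1, each exactly once, and that the product of the
    matrices [X] over [Q] has as (s, t) entry the sum of the weights of all
    restricted paths that start from the frontier edge of index s and end at the
    south-east edge labelled t.

    When [Q] is empty the frontier is the south-east border, where an index is a
    label, so all that is needed is that the labels of the border run through
    0, ..., n-1 without repetition ([border_labels]).  When a cell b is added,
    the frontier exchanges the east and south edges of b for its west and north
    edges ([frontier_consE]); the two pipes through b pass from the first pair to
    the second, so the indices do not change.  Left multiplication by
    X_(i,j)(beta) adds beta times row j to row i ([X_mx_mulE]).  On the side of
    paths, a path entering b through its north edge must follow its pipe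
    ([walk_sum_north]), whereas one entering through its west edge, on pipe i,
    may also jump to pipe j with weight beta ([walk_sum_west]).  It is there that
    the Go condition is used: in an elbow it says that j is below i, in a black
    crossing this holds by definition, and at a white stone beta vanishes.

    When [Q] is the whole diagram the frontier is the north-west border.

    The remaining work is bookkeeping.  The row number plus the column number of
    an edge grows by one at every step along a pipe or a path
    ([edge_rank]); hence pipes and paths have fewer than n steps, the bounds on
    their lengths do no harm, and a path meets a cell at most once, so that its
    weight is multiplicative ([path_weight_cons]). *)

(** * Cells and edges of a partition *)

(** The entries exceeding c form an initial segment of a nonincreasing sequence,
    so their number is the index where they stop: the defining property of the
    conjugate partition. *)
Lemma sorted_geq_count (s : seq nat) (c y : nat) :
  sorted geq s -> (y < size s)%N ->
  (y < count (fun p => c < p)%N s)%N = (c < nth 0%N s y)%N.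
Proof.
have geq_trans : transitive geq by move=> a b d /= H1 H2; lia.
elim: s y => [|p s IH] y //= sp ys.
have := order_path_min geq_trans sp; move/allP => pmin.
case: y ys => [|y] ys /=.
  case: (ltnP c p) => cp //=; rewrite ?add0n.
  by rewrite -has_count; apply/hasPn => q /pmin /= qp; lia.
case: (ltnP c p) => cp /=; first by rewrite ltnS IH // (path_sorted sp).
rewrite ?add0n; have q_le q : q \in s -> (q <= c)%N by move/pmin => /= ?; lia.
have -> : count (fun p => c < p)%N s = 0%N.
  by apply/eqP; rewrite -leqn0 leqNgt -has_count; apply/hasPn => q /q_le; lia.
by symmetry; apply/negbTE; rewrite -leqNgt; apply: q_le; rewrite mem_nth.
Qed.

Section Geometry.
Variables (k n : nat) (lam : box_partition k n).
Implicit Types (b : cell lam) (e : edge k n).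

Lemma part_le (r : 'I_k) : (tnth lam r <= n - k)%N.
Proof.
apply: leq_trans (parts_le lam); rewrite (tnth_nth 0%N).
have geq_trans : transitive geq by move=> a b d /= H1 H2; lia.
have := sorted_leq_nth geq_trans (fun x => leqnn x) 0%N (parts_sorted lam).
by apply; rewrite ?inE ?size_tuple //; case: r => // r; apply: leq_trans.
Qed.

Lemma conjugate_partE (c : nat) (y : 'I_k) :
  (y < count (fun p => c < p)%N lam)%N = (c < tnth lam y)%N.
Proof.
by rewrite sorted_geq_count ?size_tuple ?(tnth_nth 0%N) //; apply: parts_sorted.
Qed.

Lemma conjugate_part_le (c : nat) : (count (fun p => c < p)%N lam <= k)%N.
Proof. by rewrite (leq_trans (count_size _ _)) // size_tuple. Qed.

Lemma cell_inside b : (cell_col b < tnth lam (cell_row b))%N.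
Proof. exact: (valP b). Qed.

Lemma cell_exists (r : 'I_k) (c : 'I_(n - k)) : (c < tnth lam r)%N ->
  exists b : cell lam, cell_row b = r /\ cell_col b = c.
Proof.
by move=> cr; exists (exist (fun b : 'I_k * 'I_(n - k) => b.2 < tnth lam b.1)%N
                        (r, c) cr).
Qed.

Lemma mem_nw_edges b e : (e \in nw_edges b) =
  match e with
  | inl (r, x) => (r == cell_row b :> nat) && (x == cell_col b :> nat)
  | inr (y, c) => (y == cell_row b :> nat) && (c == cell_col b :> nat)
  end.
Proof.
have hr := ltn_ord (cell_row b); have hc := ltn_ord (cell_col b).
case: e => [] [u v]; rewrite !inE /west /north /eq_op /= ?orbF /eq_op /=.
  by rewrite -!val_eqE /= inordK //; lia.
by rewrite -!val_eqE /= inordK //; lia.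
Qed.

Lemma mem_se_edges b e : (e \in se_edges b) =
  match e with
  | inl (r, x) => (r == cell_row b :> nat) && (x == (cell_col b).+1 :> nat)
  | inr (y, c) => (y == (cell_row b).+1 :> nat) && (c == cell_col b :> nat)
  end.
Proof.
have hr := ltn_ord (cell_row b); have hc := ltn_ord (cell_col b).
case: e => [] [u v]; rewrite !inE /east /south /eq_op /= ?orbF /eq_op /=.
  by rewrite -!val_eqE /= inordK //; lia.
by rewrite -!val_eqE /= inordK //; lia.
Qed.

Lemma cell_eqP b b' : cell_row b = cell_row b' :> nat ->
  cell_col b = cell_col b' :> nat -> b = b'.
Proof.
move=> /val_inj hr /val_inj hc; apply: val_inj; move: hr hc.
by rewrite /cell_row /cell_col; case: (val b) (val b') => [? ?] [? ?] /= -> ->.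
Qed.

Lemma nw_edges_inj b b' e : e \in nw_edges b -> e \in nw_edges b' -> b = b'.
Proof.
rewrite !mem_nw_edges; case: e => [] [u v] /andP[/eqP H1 /eqP H2]
  /andP[/eqP H3 /eqP H4];
  apply: cell_eqP; lia.
Qed.

Lemma se_edges_inj b b' e : e \in se_edges b -> e \in se_edges b' -> b = b'.
Proof.
rewrite !mem_se_edges; case: e => [] [u v] /andP[/eqP H1 /eqP H2]
  /andP[/eqP H3 /eqP H4];
  apply: cell_eqP; lia.
Qed.

Lemma nw_not_se_border b e : e \in nw_edges b -> se_border lam e = false.
Proof.
have hb := cell_inside b.
rewrite mem_nw_edges; case: e => [] [u v] /andP[/eqP H1 /eqP H2] /=.
  by move: hb; rewrite -(ord_inj H1); lia.
by move: hb; rewrite -conjugate_partE -H2; lia.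
Qed.

(** The only way to leave the diagram through a cell is across its south-east
    border. *)
Lemma se_border_or_nw b e : e \in se_edges b ->
  se_border lam e || [exists b', e \in nw_edges (lam := lam) b'].
Proof.
have hb := cell_inside b; rewrite mem_se_edges.
case: e => [] [u v] /andP[/eqP H1 /eqP H2] /=.
  case: eqP => //= H; move: hb; rewrite -(ord_inj H1) => hb.
  have hu := part_le u; have lt_v : (v < n - k)%N by lia.
  have [|b' [hr hc]] := @cell_exists u (Ordinal lt_v); first by rewrite /=; lia.
  by apply/existsP; exists b'; rewrite mem_nw_edges hr hc /= !eqxx.
case: eqP => //= H; move: hb; rewrite -conjugate_partE -H2 => hb.
have hu := conjugate_part_le v; have lt_u : (u < k)%N by lia.
have [|b' [hr hc]] := @cell_exists (Ordinal lt_u) v.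
  by rewrite -conjugate_partE /=; lia.
by apply/existsP; exists b'; rewrite mem_nw_edges hr hc /= !eqxx.
Qed.

(** The right-hand side is the membership condition of [frontier] below, taken
    for the set of all cells. *)
Lemma nw_borderE e : nw_border e =
  (se_border lam e || [exists b : cell lam, e \in nw_edges b])
  && ~~ [exists b : cell lam, e \in se_edges b].
Proof.
apply/idP/andP => [he|[]].
  split; last first.
    apply/existsPn => b; rewrite mem_se_edges.
    by case: e he => [] [u v] /= /eqP H; lia.
  case: e he => [] [u v] /= /eqP H; case: eqP => //= H'; apply/existsP.
    have hu := part_le u; have lt_v : (v < n - k)%N by lia.
    have [|b' [hr hc]] := @cell_exists u (Ordinal lt_v); first by rewrite /=; lia.
    by exists b'; rewrite mem_nw_edges hr hc /= !eqxx.
  have hu := conjugate_part_le v; have lt_u : (u < k)%N by lia.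
  have [|b' [hr hc]] := @cell_exists (Ordinal lt_u) v.
    by rewrite -conjugate_partE /=; lia.
  by exists b'; rewrite mem_nw_edges hr hc /= !eqxx.
move=> H1 /existsPn H2; case: e H1 H2 => [] [u v] /= H1 H2; apply/negPn/negP => nz.
  have lt_v : (v.-1 < n - k)%N by have := ltn_ord v; lia.
  have le_v : (v <= tnth lam u)%N.
    case/orP: H1 => [/eqP-> //|/existsP[b]]; have := cell_inside b.
    by rewrite mem_nw_edges => hb /andP[/eqP/ord_inj -> /eqP ->]; lia.
  have [|b [hr hc]] := @cell_exists u (Ordinal lt_v); first by rewrite /=; lia.
  by have := H2 b; rewrite mem_se_edges hr hc /=; lia.
have lt_u : (u.-1 < k)%N by have := ltn_ord u; lia.
have le_u : (u <= count (fun p => v < p)%N lam)%N.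
  case/orP: H1 => [/eqP-> //|/existsP[b]]; have := cell_inside b.
  by rewrite mem_nw_edges -conjugate_partE => hb /andP[/eqP -> /eqP ->]; lia.
have [|b [hr hc]] := @cell_exists (Ordinal lt_u) v.
  by rewrite -conjugate_partE /=; lia.
by have := H2 b; rewrite mem_se_edges hr hc /=; lia.
Qed.

(** Up to a constant, the number of steps from the north-west corner to the
    midpoint of the edge; a step through any cell increases it by one. *)
Definition edge_rank e : nat :=
  match e with inl (r, x) => (r + x)%N | inr (y, c) => (y + c)%N end.

Lemma edge_rank_lt (hkn : (k <= n)%N) e : (edge_rank e < n)%N.
Proof.
by case: e => [] [u v] /=; have := ltn_ord u; have := ltn_ord v; lia.
Qed.

Lemma edge_rank_nw b e : e \in nw_edges b ->
  edge_rank e = (cell_row b + cell_col b)%N.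
Proof. by rewrite mem_nw_edges; case: e => [] [u v] /=; lia. Qed.

Lemma edge_rank_se b e : e \in se_edges b ->
  edge_rank e = (cell_row b + cell_col b).+1.
Proof. by rewrite mem_se_edges; case: e => [] [u v] /=; lia. Qed.

(** The south-east border has one vertical edge in each row and one horizontal
    edge in each column of the rectangle. *)
Definition border_edge (i : 'I_k + 'I_(n - k)) : edge k n :=
  match i with
  | inl r => inl (r, inord (tnth lam r))
  | inr c => inr (inord (count (fun p => c < p)%N lam), c)
  end.

Lemma border_edgeP e : reflect (exists i, e = border_edge i) (se_border lam e).
Proof.
apply: (iffP idP) => [|[[r|c] ->]] /=.
- case: e => [] [u v] /= /eqP H.
    by exists (inl u); rewrite /= -H inord_val.
  exists (inr v); congr (inr (_, _)).
  by apply: val_inj; rewrite /= inordK // ltnS conjugate_part_le.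
- by rewrite inordK // ltnS part_le.
- by apply/eqP/inordK; rewrite ltnS conjugate_part_le.
Qed.

Lemma border_edge_inj : injective border_edge.
Proof. by case=> [r|c] [r'|c'] //= [] // => [->|_ ->]. Qed.

Lemma se_label_border (i : 'I_k + 'I_(n - k)) : se_label (border_edge i) =
  match i with
  | inl r => (r + (n - k - tnth lam r))%N
  | inr c => (count (fun p => c < p)%N lam + (n - k - c.+1))%N
  end.
Proof.
case: i => [r|c]; congr (_ + _)%N.
  by rewrite inordK // ltnS part_le.
by apply: inordK; rewrite ltnS conjugate_part_le.
Qed.

Lemma part_mono (r r' : 'I_k) : (r <= r')%N -> (tnth lam r' <= tnth lam r)%N.
Proof.
move=> rr'; rewrite leqNgt -conjugate_partE -leqNgt.
by have := conjugate_partE (tnth lam r) r; lia.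
Qed.

Lemma conjugate_part_mono (c c' : nat) : (c <= c')%N ->
  (count (fun p => c' < p)%N lam <= count (fun p => c < p)%N lam)%N.
Proof. by move=> cc'; apply: sub_count => p /=; lia. Qed.

(** Labels increase down the vertical edges and decrease to the right along the
    horizontal ones.  A vertical edge in row r precedes the horizontal edge in
    column c exactly when the cell (r, c) is in the diagram, and
    [conjugate_partE] translates this into c < lambda_r and into r < lambda'_c. *)
Lemma border_label_inj : injective (fun i => se_label (border_edge i)).
Proof.
move=> i j; rewrite /= !se_label_border; case: i j => [r|c] [r'|c'].
- have hr := part_le r; have hr' := part_le r'.
  case: (ltngtP r r') => [/[dup] + /ltnW/part_mono
                         |/[dup] + /ltnW/part_mono|/ord_inj-> //];
  by lia.
- have := conjugate_partE c' r; have := ltn_ord c'; have := part_le r.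
  by lia.
- have := conjugate_partE c r'; have := ltn_ord c; have := part_le r'.
  by lia.
- have hc := ltn_ord c; have hc' := ltn_ord c'.
  case: (ltngtP c c') => [/[dup] + /ltnW/conjugate_part_mono
                         |/[dup] + /ltnW/conjugate_part_mono|/ord_inj-> //];
  by lia.
Qed.

Lemma border_labels (hkn : (k <= n)%N) :
  perm_eq [seq se_label e | e <- enum (edge k n) & se_border lam e] (iota 0 n).
Proof.
have perm_border : perm_eq [seq e <- enum (edge k n) | se_border lam e]
                           [seq border_edge i | i : 'I_k + 'I_(n - k)].
  apply: uniq_perm; first by rewrite filter_uniq // enum_uniq.
    by rewrite map_inj_uniq ?enum_uniq //; apply: border_edge_inj.
  move=> e; rewrite mem_filter mem_enum andbT.
  by apply/border_edgeP/imageP => [[i ->]|[i _ ->]]; exists i.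
rewrite (perm_trans (perm_map _ perm_border)) // -map_comp.
have labels_uniq : uniq [seq se_label (border_edge i) | i : 'I_k + 'I_(n - k)].
  by rewrite map_inj_uniq ?enum_uniq //; apply: border_label_inj.
have labels_lt : {subset [seq se_label (border_edge i) | i : 'I_k + 'I_(n - k)]
                   <= iota 0 n}.
  move=> m /imageP[i _ ->]; rewrite mem_iota /= add0n se_label_border.
  case: i => [r|c]; first by have := ltn_ord r; have := part_le r; lia.
  by have := conjugate_part_le c; have := ltn_ord c; lia.
apply: uniq_perm => //; first exact: iota_uniq.
apply: (uniq_min_size labels_uniq labels_lt _).2.
by rewrite size_iota size_map -cardE card_sum !card_ord subnKC.
Qed.

End Geometry.

(** * Pipes *)

Section Pipes.
Variables (k n : nat) (lam : box_partition k n) (D : pipe_dream lam).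
Implicit Types (b : cell lam) (e : edge k n).

Lemma west_nw b : west b \in nw_edges b.
Proof. by rewrite inE eqxx. Qed.

Lemma north_nw b : north b \in nw_edges b.
Proof. by rewrite !inE eqxx orbT. Qed.

Lemma pipe_entries b : perm_eq [:: pipe_entry D b (west b); pipe_entry D b (north b)]
                               (se_edges b).
Proof.
rewrite /pipe_entry eqxx; case: (D b) => //=.
by apply/permPl; apply: (perm_catC [:: south b] [:: east b]).
Qed.

Lemma pipe_entry_se b e : pipe_entry D b e \in se_edges b.
Proof. by rewrite !inE /pipe_entry; case: (D b); case: ifP; rewrite eqxx ?orbT. Qed.

Lemma pipe_back_nw b e : e \in nw_edges b -> pipe_back D e = pipe_entry D b e.
Proof.
move=> eb; rewrite /pipe_back; case: pickP => [b' eb'|/(_ b)]; last by rewrite eb.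
by rewrite (nw_edges_inj eb' eb).
Qed.

Lemma pipe_back_id e : (forall b, e \notin nw_edges b) -> pipe_back D e = e.
Proof.
move=> eN; rewrite /pipe_back; case: pickP => // b eb.
by have := eN b; rewrite eb.
Qed.

Lemma pipe_back_rank e :
  pipe_back D e = e \/ edge_rank (pipe_back D e) = (edge_rank e).+1.
Proof.
case: (pickP (fun b => e \in nw_edges b)) => [b eb|eN]; last first.
  by left; apply: pipe_back_id => b; rewrite eN.
right; rewrite (pipe_back_nw eb) (edge_rank_nw eb).
exact: edge_rank_se (pipe_entry_se b e).
Qed.

(** A backward step that moves raises the rank, which stays below n. *)
Lemma pipe_back_stable (hkn : (k <= n)%N) m e : (n <= edge_rank e + m.+1)%N ->
  iter m.+1 (pipe_back D) e = iter m (pipe_back D) e.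
Proof.
elim: m e => [|m IH] e hm; case: (pipe_back_rank e) => eE.
- by rewrite /= eE.
- by have := edge_rank_lt hkn (pipe_back D e); lia.
- by rewrite iterSr eE.
- by rewrite iterSr IH; [rewrite -iterSr | lia].
Qed.

Lemma pipe_index_entry (hkn : (k <= n)%N) b e : e \in nw_edges b ->
  pipe_index D e = pipe_index D (pipe_entry D b e).
Proof.
move=> eb; rewrite /pipe_index -(pipe_back_nw eb) -iterSr pipe_back_stable //.
by lia.
Qed.

Lemma pipe_index_border e : se_border lam e -> pipe_index D e = se_label e.
Proof.
move=> ebd; rewrite /pipe_index; congr se_label; apply: iter_fix.
by apply: pipe_back_id => b; apply/negP => /nw_not_se_border; rewrite ebd.
Qed.

(** * Restricted paths *)

Lemma restricted_step_nw b e e' : e \in nw_edges b ->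
  restricted_step D e e' = follows D b e e' || jumps D b e e'.
Proof.
move=> eb; apply/existsP/idP => [[b']|]; last by exists b.
case/orP => [/[dup] + /andP[eb' _]|/[dup] + /andP[eb' _]];
  by rewrite (nw_edges_inj eb' eb) => ->; rewrite ?orbT.
Qed.

Lemma restricted_step_cell e e' : restricted_step D e e' ->
  exists b, (e \in nw_edges b) && (e' \in se_edges b).
Proof.
case/existsP => b /orP[/andP[eb /eqP ->]|/and3P[eb eb' _]]; exists b; rewrite eb //.
exact: pipe_entry_se.
Qed.

Lemma restricted_step_rank e e' : restricted_step D e e' ->
  edge_rank e' = (edge_rank e).+1.
Proof.
by case/restricted_step_cell => b /andP[/edge_rank_nw -> /edge_rank_se ->].
Qed.

Lemma jump_site_rank e p b : path (restricted_step D) e p -> jump_site D e p b ->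
  (edge_rank e <= cell_row b + cell_col b)%N.
Proof.
elim: p e => [|e' p IH] e //= /andP[st pth] /orP[/andP[eb _]|js].
  by rewrite (edge_rank_nw eb).
by have := IH _ pth js; rewrite (restricted_step_rank st); apply: leq_trans.
Qed.

Section WalkSums.
Variables (F : fieldType) (beta : cell lam -> F).

(** The weight of a path is a product over its set of jump sites, so this needs
    that the cell crossed by the first step is not met again; all later edges
    have a rank too large to be on its north-west side. *)
Lemma path_weight_cons e e' p : path (restricted_step D) e (e' :: p) ->
  path_weight D beta e (e' :: p) =
    (\prod_(b | jumps D b e e') beta b) * path_weight D beta e' p.
Proof.
move=> /= /andP[st pth]; rewrite /path_weight (bigID (fun b => jumps D b e e')) /=.
congr (_ * _); apply: eq_bigl => b; rewrite /jump_site /=.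
  by case: jumps; rewrite ?andbF.
case: (boolP (jumps D b e e')) => [/andP[eb _]|_]; rewrite ?andbT ?andbF //=.
symmetry; apply/negbTE/negP => /(jump_site_rank pth).
by rewrite (restricted_step_rank st) (edge_rank_nw eb) ltnn.
Qed.

Lemma big_bseq_cons (T : finType) (m : nat) (f : seq T -> F) :
  \sum_(p : {bseq m.+1 of T}) f p =
    f [::] + \sum_(x : T) \sum_(p : {bseq m of T}) f (x :: p).
Proof.
pose S (l : nat) : seq (seq T) := [seq val p | p <- enum {: {bseq l of T}}].
have memS l p : (p \in S l) = (size p <= l)%N.
  apply/mapP/idP => [[q _ ->]|pl]; first exact: size_bseq.
  by exists (Bseq pl) => //; rewrite mem_enum.
have sumS l (g : seq T -> F) : \sum_(p : {bseq l of T}) g p = \sum_(p <- S l) g p.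
  by rewrite big_map big_enum.
have S_cons : perm_eq (S m.+1) ([::] :: [seq x :: p | x <- enum T, p <- S m]).
  apply: uniq_perm; first by rewrite map_inj_uniq ?enum_uniq //; apply: val_inj.
    rewrite /= allpairs_uniq ?enum_uniq ?andbT //.
    - by apply/negP => /allpairsP[[x p] [_ _]].
    - by rewrite map_inj_uniq ?enum_uniq //; apply: val_inj.
    - by move=> [x p] [x' p'] _ _ [-> ->].
  move=> [|x p]; rewrite memS inE //=; symmetry; rewrite ltnS -memS.
  apply/allpairsP/idP => [[[y q] [_ hq [_ ->]]] //|hp].
  by exists (x, p); rewrite mem_enum.
rewrite sumS (perm_big _ S_cons) big_cons big_allpairs_dep big_enum /=.
by congr (_ + _); apply: eq_bigr => x _; rewrite (sumS m (fun p => f (x :: p))).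
Qed.

Definition walk e (t : nat) p :=
  [&& path (restricted_step D) e p, se_border lam (last e p)
    & se_label (last e p) == t].

(** The bound [m] on the length is a parameter so that the recursion on the first
    step can be stated; by [walk_sum_stable] the values m >= n - 1 all give the
    sum over all paths. *)
Definition walk_sum (m : nat) e (t : nat) : F :=
  \sum_(p : {bseq m of edge k n} | walk e t p) path_weight D beta e p.

Lemma path_weight_nil e : path_weight D beta e [::] = 1.
Proof. by rewrite /path_weight big_pred0. Qed.

Lemma walk_sum0 e t :
  walk_sum 0 e t = (se_border lam e && (se_label e == t))%:R.
Proof.
rewrite /walk_sum big_mkcond /= (bigD1 [bseq]) //= big1 ?addr0.
  by rewrite /walk /= path_weight_nil; case: ifP.
by move=> p; rewrite bseq0 eqxx.
Qed.

Lemma walk_sumS m e t : walk_sum m.+1 e t =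
  (se_border lam e && (se_label e == t))%:R +
  \sum_(e' | restricted_step D e e')
    (\prod_(b | jumps D b e e') beta b) * walk_sum m e' t.
Proof.
rewrite /walk_sum big_mkcond.
rewrite (big_bseq_cons m (fun p => if walk e t p then path_weight D beta e p else 0)).
congr (_ + _); first by rewrite /walk /= path_weight_nil; case: ifP.
rewrite [RHS]big_mkcond; apply: eq_bigr => e' _.
case: ifP => st; last by rewrite big1 // => p _; rewrite /walk /= st.
rewrite big_distrr [RHS]big_mkcond; apply: eq_bigr => p _.
rewrite /walk /= st /=; case: ifP => // /and3P[pth _ _].
by rewrite path_weight_cons //= st.
Qed.

Lemma walk_sum_stable (hkn : (k <= n)%N) m e t : (n <= edge_rank e + m.+1)%N ->
  walk_sum m.+1 e t = walk_sum m e t.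
Proof.
elim: m e => [|m IH] e hm; rewrite walk_sumS.
  rewrite walk_sum0 big1 ?addr0 // => e' /restricted_step_rank.
  by have := edge_rank_lt hkn e'; lia.
rewrite walk_sumS; congr (_ + _); apply: eq_bigr => e' st.
by rewrite IH // (restricted_step_rank st); lia.
Qed.

Lemma walk_sum_border (hkn : (k <= n)%N) t e : se_border lam e ->
  walk_sum n e t = (se_label e == t)%:R.
Proof.
move=> ebd; rewrite -(walk_sum_stable hkn) ?walk_sumS ?ebd /=; last by lia.
rewrite big_pred0 ?addr0 // => e'; apply/negbTE/negP => /restricted_step_cell[b].
by case/andP => /nw_not_se_border; rewrite ebd.
Qed.

Lemma walk_sum_step (hkn : (k <= n)%N) t e : ~~ se_border lam e ->
  walk_sum n e t = \sum_(e' | restricted_step D e e')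
    (\prod_(b | jumps D b e e') beta b) * walk_sum n e' t.
Proof.
move=> ebd; rewrite -{1}(walk_sum_stable hkn) ?walk_sumS ?(negbTE ebd) /= ?add0r //.
by lia.
Qed.

End WalkSums.
End Pipes.

(** * Crossing one cell *)

(** Multiplying by X_(i,j)(a) on the left is a row operation.  For i = j, where
    [X_mx] is the identity, the formula can fail. *)
Lemma X_mx_mulE (F : fieldType) (n i : nat) (j : 'I_n) (a : F) (S : 'M[F]_n)
    (s t : 'I_n) : i != j ->
  (X_mx n (i, j : nat) a *m S) s t = S s t + (if i == s then a * S j t else 0).
Proof.
move=> ij; rewrite mxE (eq_bigr (fun u => (s == u)%:R * S u t +
    (if u == j then if i == s then a * S j t else 0 else 0))); last first.
  move=> u _; rewrite mxE /= -[u == j]val_eqE /= (eq_sym i).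
  case: (eqVneq s u) => [<-|su]; last first.
    rewrite mul0r add0r; case: (s == i :> nat); last by rewrite mul0r if_same.
    by case: eqP => [/val_inj -> //|]; rewrite mul0r.
  rewrite mul1r; case: eqP => [sj|]; last by rewrite addr0.
  by rewrite sj eq_sym (negbTE ij) addr0.
rewrite big_split /= -big_mkcond big_pred1_eq; congr (_ + _).
rewrite (bigD1 s) //= eqxx mul1r big1 ?addr0 // => u us.
by rewrite eq_sym (negbTE us) mul0r.
Qed.

Section LocalRule.
Variables (k n : nat) (hkn : (k <= n)%N).
Variables (lam : box_partition k n) (D : pipe_dream lam).
Variables (F : fieldType) (beta : cell lam -> F).
Implicit Types (b : cell lam) (e : edge k n).

(** At a jump cell the lower pipe is the one leaving by the north edge: in an
    elbow this is the Go condition, in a crossing it is the colour black. *)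
Lemma go_index_le b : go_diagram D -> cell_mark D b <> WhiteStone ->
  (pipe_index D (north b) <= pipe_index D (west b))%N.
Proof.
rewrite !(pipe_index_entry D hkn (west_nw b)) !(pipe_index_entry D hkn (north_nw b)).
move=> /(_ b); rewrite /cell_mark /pipe_entry eqxx.
have -> : (north b == west b) = false by [].
case: (D b) => [_|/(_ erefl) /negP]; last by rewrite -leqNgt.
by case: ltnP.
Qed.

Lemma step_weightE b e e' : e \in nw_edges b ->
  \prod_(b' | jumps D b' e e') beta b' = if jumps D b e e' then beta b else 1.
Proof.
move=> eb; have only_b b' : jumps D b' e e' = (b' == b) && jumps D b e e'.
  case: eqP => [-> //|nb]; apply/negbTE/negP => /andP[eb' _].
  by case: nb; apply: nw_edges_inj eb' eb.
case: ifP => jb; last by rewrite big_pred0 // => b'; rewrite only_b jb andbF.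
by apply: big_pred1 => b'; rewrite only_b jb andbT.
Qed.

Lemma pipe_entry_neq b : pipe_entry D b (west b) != pipe_entry D b (north b).
Proof. by rewrite /pipe_entry eqxx; case: (D b). Qed.

Lemma mem_se_entries b e :
  (e \in se_edges b) = (e == pipe_entry D b (west b)) || (e == pipe_entry D b (north b)).
Proof. by rewrite -(perm_mem (pipe_entries D b)) !inE. Qed.

Lemma jumps_north b e : go_diagram D -> jumps D b (north b) e = false.
Proof.
move=> go; apply/negbTE/negP => /and5P[_]; rewrite mem_se_entries.
case: (e == _) / eqP => [-> _ _|_ /= -> //].
rewrite -(pipe_index_entry D hkn (west_nw b)) => mk.
by rewrite ltnNge go_index_le //; case: cell_mark mk.
Qed.

Lemma jumps_west b e : go_diagram D ->
  pipe_index D (west b) != pipe_index D (north b) ->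
  jumps D b (west b) e = (e == pipe_entry D b (north b)) &&
                         (if cell_mark D b is WhiteStone then false else true).
Proof.
move=> go neq; rewrite /jumps west_nw mem_se_entries /=.
case: eqP => [->|_] /=.
  by rewrite ?eqxx (negbTE (pipe_entry_neq b)).
case: eqP => [->|_] //=.
case mk: (cell_mark D b) => //=; rewrite -(pipe_index_entry D hkn (north_nw b));
  by rewrite ltn_neqAle eq_sym neq go_index_le // mk.
Qed.

Lemma walk_sum_north b t : go_diagram D ->
  walk_sum D beta n (north b) t = walk_sum D beta n (pipe_entry D b (north b)) t.
Proof.
move=> go; rewrite walk_sum_step ?(nw_not_se_border (north_nw b)) //.
rewrite (big_pred1 (pipe_entry D b (north b))) => [|e].
  by rewrite (step_weightE _ (north_nw b)) jumps_north // mul1r.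
by rewrite (restricted_step_nw D e (north_nw b)) jumps_north // orbF /follows north_nw.
Qed.

(** At a white stone no jump is possible, which agrees with the second summand
    because beta is zero there. *)
Lemma walk_sum_west b t : go_diagram D -> jump_parameters D beta ->
  pipe_index D (west b) != pipe_index D (north b) ->
  walk_sum D beta n (west b) t = walk_sum D beta n (pipe_entry D b (west b)) t +
    beta b * walk_sum D beta n (pipe_entry D b (north b)) t.
Proof.
move=> go hbeta neq; rewrite walk_sum_step ?(nw_not_se_border (west_nw b)) //.
have stepE e : restricted_step D (west b) e =
    (e == pipe_entry D b (west b)) || jumps D b (west b) e.
  by rewrite (restricted_step_nw D e (west_nw b)) /follows west_nw.
rewrite (bigD1 (pipe_entry D b (west b))) ?stepE ?eqxx //=.
rewrite (step_weightE _ (west_nw b)) jumps_west // (negbTE (pipe_entry_neq b)) mul1r.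
congr (_ + _); case mk : (if cell_mark D b is WhiteStone then false else true).
  rewrite (big_pred1 (pipe_entry D b (north b))) => [|e].
    by rewrite (step_weightE _ (west_nw b)) jumps_west // eqxx mk.
  rewrite stepE jumps_west // mk andbT; case: eqP => [->|_] /=.
    by rewrite (negbTE (pipe_entry_neq b)).
  by rewrite andbT.
have -> : beta b = 0 by have := hbeta b; case: cell_mark mk.
rewrite mul0r big_pred0 // => e; rewrite stepE jumps_west // mk andbF orbF.
by case: eqP.
Qed.

End LocalRule.

(** * The frontier of a final set of cells *)

Section Frontier.
Variables (k n : nat) (hkn : (k <= n)%N).
Variables (lam : box_partition k n) (rd : cell lam -> nat).
Implicit Types (b : cell lam) (e : edge k n) (Q : seq (cell lam)).

(** The edges on the border of the union of [Q] that face north or west,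
    completed by the south-east border edges not reached by [Q].  This is the
    lattice path separating [Q] from the other cells. *)
Definition frontier Q : seq (edge k n) :=
  [seq e <- enum (edge k n) |
    (se_border lam e || has (fun b => e \in nw_edges b) Q)
    && ~~ has (fun b => e \in se_edges b) Q].

Lemma mem_frontier Q e : (e \in frontier Q) =
  (se_border lam e || has (fun b => e \in nw_edges b) Q)
    && ~~ has (fun b => e \in se_edges b) Q.
Proof. by rewrite mem_filter mem_enum andbT. Qed.

Lemma frontier_uniq Q : uniq (frontier Q).
Proof. by rewrite filter_uniq // enum_uniq. Qed.

Lemma reading_order_adjacent b b' e : reading_order rd ->
  e \in se_edges b -> e \in nw_edges b' -> (rd b' < rd b)%N.
Proof.
case=> _ rows cols; rewrite mem_se_edges mem_nw_edges.
case: e => [] [u v] /andP[/eqP H1 /eqP H2] /andP[/eqP H3 /eqP H4].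
  by apply: rows; [apply: ord_inj|]; lia.
by apply: cols; [apply: ord_inj|]; lia.
Qed.

(** The possible tails of the list of cells in decreasing reading order. *)
Definition reading_suffix Q : Prop :=
  sorted (fun b b' => rd b' < rd b)%N Q /\
  forall b b', b \in Q -> (rd b' < rd b)%N -> b' \in Q.

Lemma reading_suffix_behead b Q : reading_suffix (b :: Q) ->
  reading_suffix Q /\ forall b', (b' \in Q) = (rd b' < rd b)%N.
Proof.
have rd_trans : transitive (fun b b' => rd b' < rd b)%N.
  by move=> x y z /= xy zx; apply: ltn_trans zx xy.
case=> srt low; have /allP lt_b := order_path_min rd_trans srt.
have memQ b' : (b' \in Q) = (rd b' < rd b)%N.
  apply/idP/idP => [/lt_b //|lt].
  have := low b b' (mem_head _ _) lt; rewrite inE => /predU1P[eq_b|//].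
  by rewrite eq_b ltnn in lt.
split=> //; split; first exact: path_sorted srt.
by move=> c b'; rewrite !memQ => cb /ltn_trans; apply.
Qed.

(** The reading order ensures that every cell south or east of b is in [Q], so
    that the east and south edges of b are on the frontier of [Q], and that no
    cell of [Q] is north or west of b. *)
Lemma frontier_consE b Q : reading_order rd -> reading_suffix (b :: Q) ->
  let G := [seq e <- frontier Q | e \notin se_edges b] in
  perm_eq (frontier (b :: Q)) (nw_edges b ++ G) /\
  perm_eq (frontier Q) (se_edges b ++ G).
Proof.
move=> ro /reading_suffix_behead[_ memQ] G.
have bQ : b \notin Q by rewrite memQ ltnn.
have nw_se e : e \in nw_edges b -> e \in se_edges b = false.
  move=> nw; apply/negbTE/negP => se.
  by have := reading_order_adjacent ro se nw; rewrite ltnn.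
have nw_seQ e : e \in nw_edges b -> has (fun b' => e \in se_edges b') Q = false.
  move=> nw; apply/negbTE/hasPn => b'; rewrite memQ => lt; apply/negP => se.
  by have := reading_order_adjacent ro se nw; rewrite ltnNge ltnW.
have nw_nwQ e : e \in nw_edges b -> has (fun b' => e \in nw_edges b') Q = false.
  move=> nw; apply/negbTE/hasPn => b' b'Q; apply/negP => nw'.
  by move: bQ; rewrite (nw_edges_inj nw nw') b'Q.
have seQ e : e \in se_edges b -> e \in frontier Q.
  move=> se; rewrite mem_frontier; apply/andP; split; last first.
    apply/hasPn => b' b'Q; apply/negP => se'.
    by move: bQ; rewrite (se_edges_inj se se') b'Q.
  have := se_border_or_nw se; case: (se_border lam e) => //= /existsP[b' nw].
  by apply/hasP; exists b' => //; rewrite memQ (reading_order_adjacent ro se nw).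
split; apply: uniq_perm; try exact: frontier_uniq.
- rewrite cat_uniq filter_uniq ?frontier_uniq // andbT.
  apply/andP; split; first by [].
  apply/hasPn => e; rewrite mem_filter mem_frontier => /andP[_ eF].
  apply/negP => nw; move: eF.
  by rewrite nw_nwQ // (nw_not_se_border nw).
- move=> e; rewrite mem_cat [e \in G]mem_filter !mem_frontier /=.
  case: (boolP (e \in nw_edges b)) => [nw|_] /=.
    by rewrite orbT nw_se // nw_seQ.
  by rewrite negb_or andbCA.
- rewrite cat_uniq filter_uniq ?frontier_uniq // andbT.
  apply/andP; split; first by [].
  by apply/hasPn => e; rewrite mem_filter => /andP[].
- move=> e; rewrite mem_cat [e \in G]mem_filter.
  by case: (boolP (e \in se_edges b)) => [/seQ ->|].
Qed.

Variables (D : pipe_dream lam) (F : fieldType) (beta : cell lam -> F).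

Lemma frontier_invariant Q : reading_order rd -> go_diagram D ->
  jump_parameters D beta -> reading_suffix Q ->
  perm_eq [seq pipe_index D e | e <- frontier Q] (iota 0 n) /\
  forall s t : 'I_n,
    (\prod_(b <- Q) X_mx n (jump_coordinate D b) (beta b)) s t =
    \sum_(e <- frontier Q | pipe_index D e == s) walk_sum D beta n e t.
Proof.
move=> ro go hbeta; elim: Q => [_|b Q IH sfx].
  have frontier0 : frontier [::] = [seq e <- enum (edge k n) | se_border lam e].
    by apply: eq_filter => e; rewrite /= orbF andbT.
  have idxE : [seq pipe_index D e | e <- frontier [::]] =
              [seq se_label e | e <- enum (edge k n) & se_border lam e].
    rewrite frontier0; apply/eq_in_map => e; rewrite mem_filter => /andP[ebd _].
    exact: pipe_index_border.
  have idx_perm := border_labels lam hkn; rewrite -idxE in idx_perm.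
  split=> // s t; rewrite big_nil mxE.
  transitivity (\sum_(i <- [seq pipe_index D e | e <- frontier [::]] | i == s)
                  (i == t)%:R : F).
    rewrite (perm_big _ idx_perm) /=.
    rewrite (_ : iota 0 n = index_iota 0 n); last by rewrite /index_iota subn0.
    rewrite big_mkord (big_pred1 s) //.
  rewrite big_map big_seq_cond [RHS]big_seq_cond; apply: eq_bigr => e /andP[+ _].
  rewrite mem_frontier orbF andbT => ebd.
  by rewrite walk_sum_border // pipe_index_border.
have [sfxQ _] := reading_suffix_behead sfx.
have [idx_perm prodE] := IH sfxQ.
have [] := frontier_consE ro sfx; set G := filter _ _ => perm_nw perm_se.
have iW := pipe_index_entry D hkn (west_nw b).
have iN := pipe_index_entry D hkn (north_nw b).
(* The pipes i and j of the jump coordinate of b enter it through ew and en. *)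
set ew := pipe_entry D b (west b) in iW; set en := pipe_entry D b (north b) in iN.
have {}perm_se : perm_eq (frontier Q) ([:: ew; en] ++ G).
  by rewrite (perm_trans perm_se) // perm_cat2r perm_sym pipe_entries.
have idx_se := perm_map (pipe_index D) perm_se.
have idx_nw := perm_map (pipe_index D) perm_nw.
have {idx_nw} idx_eq : perm_eq [seq pipe_index D e | e <- frontier (b :: Q)]
                               [seq pipe_index D e | e <- frontier Q].
  by rewrite (perm_trans idx_nw) // perm_sym (perm_trans idx_se) //= iW iN.
split; first exact: perm_trans idx_eq idx_perm.
have : uniq [seq pipe_index D e | e <- frontier Q].
  by rewrite (perm_uniq idx_perm) iota_uniq.
rewrite (perm_uniq idx_se) /= inE negb_or => /and3P[/andP[neq _] enG _].
have lt_en : (pipe_index D en < n)%N.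
  have : pipe_index D en \in iota 0 n.
    by rewrite -(perm_mem idx_perm) (perm_mem idx_se) /= !inE eqxx orbT.
  by rewrite mem_iota.
move=> s t; rewrite big_cons.
rewrite -[LHS]/((X_mx n (pipe_index D (west b), pipe_index D (north b)) (beta b)
                 *m \prod_(c <- Q) X_mx n (jump_coordinate D c) (beta c)) s t).
have -> : pipe_index D (north b) = Ordinal lt_en by rewrite iN.
rewrite X_mx_mulE iW // !prodE.
rewrite !(perm_big _ perm_se) (perm_big _ perm_nw) !big_cons /= iW iN.
(* Row j of the product over Q is the path sum from en, as no other edge of the
   frontier has index j. *)
have row_en : \sum_(e <- G | pipe_index D e == pipe_index D en) walk_sum D beta n e t = 0.
  rewrite big_seq_cond big1 // => e /andP[eG /eqP eE].
  by move: enG; rewrite -eE map_f.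
rewrite row_en eqxx (negbTE neq) addr0.
rewrite walk_sum_north // walk_sum_west ?iW ?iN // -/ew -/en.
case: (_ =P _) => _; case: (_ =P _) => _; rewrite ?addr0 //; ring.
Qed.

End Frontier.

Theorem lemma3p15 (R : realType) (K : scalars) (k n : nat) (hkn : (k <= n)%N)
    (lam : box_partition k n) (D : pipe_dream lam) (hD : go_diagram D)
    (beta : cell lam -> scalar_field R K) (hbeta : jump_parameters D beta)
    (rd : cell lam -> nat) (hrd : reading_order rd) :
  Rtilde D beta =
  \prod_(b <- sort (fun b b' => rd b' <= rd b)%N (enum (cell lam)))
     X_mx n (jump_coordinate D b) (beta b).
Proof.
set Q := sort _ _.
have memQ b : b \in Q by rewrite mem_sort mem_enum.
have rd_inj : injective rd.
  have [rd_perm _ _] := hrd; apply/injectiveP.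
  by rewrite /injectiveb /dinjectiveb (perm_uniq rd_perm) iota_uniq.
have sfx : reading_suffix rd Q.
  split=> //; have : sorted (fun b b' => rd b' <= rd b)%N Q.
    by apply: sort_sorted => b b'; apply: leq_total.
  have : uniq Q by rewrite sort_uniq enum_uniq.
  elim: Q {memQ} => //= b [//|c Q] IH /andP[bQ uQ] /= /andP[le_cb srt].
  apply/andP; split; last exact: IH.
  rewrite ltn_neqAle le_cb andbT; apply: contra bQ => /eqP/rd_inj <-.
  exact: mem_head.
have [_ prodE] := frontier_invariant hkn hrd hD hbeta sfx.
apply/matrixP => s t; rewrite prodE mxE big_filter_cond.
rewrite big_enum_cond /= [LHS](bigID (fun e => nw_border e)) /= [X in _ + X]big1 ?addr0.
  apply: eq_big => [e|e /andP[_ nw]].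
    rewrite andbC (nw_borderE lam); congr (((_ || _) && ~~ _) && _);
    by apply/existsP/hasP => [[b eb]|[b _ eb]]; exists b.
  by rewrite /walk_sum; apply: eq_bigl => p; rewrite /restricted_path nw /walk /= andbA.
by move=> e /andP[_ /negbTE nw]; rewrite big_pred0 // => p; rewrite /restricted_path nw.
Qed.
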